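(* Let $\Delta, d, k \in \mathbb{N}$ with $k \ge \Delta/d + 1$. Then every graph with maximum degree at most $\Delta$ has an equitable $d$-degenerate $k$-colouring.
   Context: $\mathbb{N}$ is the set of positive integers. Graphs are finite and simple. A graph is $d$-degenerate if every (non-empty) subgraph contains a vertex of degree at most $d$ in that subgraph. A $k$-colouring of a graph $G$ is a map $\varphi: V(G)\to\{1,\dots,k\}$ (not required to be proper); its colour classes are the sets $\varphi^{-1}(i)$, $i\in\{1,\dots,k\}$ (possibly empty). It is equitable if the sizes of any two colour classes differ by at most one. It is $d$-degenerate if the subgraph of $G$ induced on each colour class is $d$-degenerate. *)

(* Defs.v *)
From mathcomp Require Import all_boot all_order all_algebra.

Set Implicit Arguments.
Unset Strict Implicit.
Unset Printing Implicit Defensive.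

Record sgraph := SGraph {
  vertex :> finType;
  adj : rel vertex;
  adj_sym : symmetric adj;
  adj_irrefl : irreflexive adj
}.

Definition degree (G : sgraph) (v : G) : nat := #|[set w | adj v w]|.

Definition max_degree (G : sgraph) : nat := \max_(v : G) degree v.

Section Induced.
Variables (G : sgraph) (A : {set G}).

Definition induced_adj : rel {x : G | x \in A} :=
  [rel x y | adj (val x) (val y)].

Lemma induced_adj_sym : symmetric induced_adj.
Proof. by move=> x y; apply: adj_sym. Qed.

Lemma induced_adj_irrefl : irreflexive induced_adj.
Proof. by move=> x; apply: adj_irrefl. Qed.

Definition induced : sgraph := SGraph induced_adj_sym induced_adj_irrefl.
End Induced.

(* Subgraphs need not be induced: [W] is the vertex set and [f] the adjacency
   relation, which may omit edges of [G] between vertices of [W]. *)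
Definition is_subgraph (G : sgraph) (W : {set G}) (f : rel G) : Prop :=
  symmetric f /\
  (forall x y, f x y -> [/\ x \in W, y \in W & adj x y]).

Definition degenerate (d : nat) (G : sgraph) : Prop :=
  forall (W : {set G}) (f : rel G),
    is_subgraph W f -> W != set0 ->
    exists2 v, v \in W & #|[set w | f v w]| <= d.

(* The colours 1, ..., k are represented by 0, ..., k - 1. *)
Definition colouring (k : nat) (G : sgraph) := {ffun G -> 'I_k}.

Definition colour_class (k : nat) (G : sgraph) (phi : colouring k G)
  (i : 'I_k) : {set G} := [set v | phi v == i].

Definition equitable (k : nat) (G : sgraph) (phi : colouring k G) : Prop :=
  forall i j : 'I_k, #|colour_class phi i| <= #|colour_class phi j| + 1.

Definition degenerate_colouring (d k : nat) (G : sgraph)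
  (phi : colouring k G) : Prop :=
  forall i : 'I_k, degenerate d (induced (colour_class phi i)).

(* Main.v *)
Require Import Defs.
From mathcomp Require Import all_boot all_order all_algebra.
From mathcomp Require Import zify.

Set Implicit Arguments.
Unset Strict Implicit.
Unset Printing Implicit Defensive.

(** Adding to a d-degenerate set a vertex with at most d neighbours in it keeps
the set d-degenerate; call such a vertex movable into that set. The proof
rearranges colour classes by such moves, and measures failure by the
(d+1)-core of a class, its largest subset of minimum degree at least d+1: the
class is d-degenerate exactly when this core is empty.

By induction on the number of vertices ([exists_colouring]) all vertices but
one, y, are coloured with prescribed sizes, except that one class V (colour j)
is one vertex short. Put y into V and let Q be the core of V + y. If some v in
Q is movable into a class X from which a chain of single moves leads to V, then
shifting one vertex along that chain restores all sizes, and Q loses v; the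
vertex that enters V has at most d neighbours there, hence never joins the core
([shift_along_path], [reroute]). Repeat until Q is empty or no such v exists.

In the second case, keep only the classes from which chains lead to V. Let A be
the set of their vertices (without y), m the number of their colours, q the
number of the other colours, P the set of vertices outside A. If some vertex of
P is movable into a kept class, shifting along a chain inserts it into A.
Otherwise every vertex of P has at least (d+1)m - 1 neighbours in A, hence,
the total degree being at most d(m+q-1), at most d(q-1) neighbours in P
([insert_or_shrink]). This has two consequences. By induction, P minus any
vertex can be coloured with the q other colours, so that it suffices to insert
any one vertex of P into the m kept classes. And the same situation has been
reached with fewer colours, with a free choice of y in P.

What makes the repetition succeed is a good choice of y. A vertex of Q that is
in A and movable into no class of A other than V has at least (d+1)m - 1 neighbours
in A, so at most dq in P; there are fewer than |P|/q vertices in V, so by counting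
some y in P has fewer than d such neighbours in V ([few_marked_neighbours]).
But y has more than d neighbours in Q whenever Q is nonempty, so one of them is
movable to another class of A. Either this reduces Q or the number of colours
goes down, and the process must end with a colouring ([extend_colouring]). *)

(** * Degrees and cores *)

Definition deg_in (G : sgraph) (S : {set G}) (x : G) : nat :=
  #|[set w in S | adj x w]|.

Definition dense (G : sgraph) (d : nat) (W : {set G}) : bool :=
  [forall v in W, d < deg_in W v].

Definition core (G : sgraph) (d : nat) (S : {set G}) : {set G} :=
  \bigcup_(W : {set G} | (W \subset S) && dense d W) W.

Lemma deg_in_mono (G : sgraph) (S T : {set G}) x :
  S \subset T -> deg_in S x <= deg_in T x.
Proof.
move=> sST; apply/subset_leq_card/subsetP=> w; rewrite !inE => /andP[wS ->].
by rewrite (subsetP sST).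
Qed.

Lemma deg_in_setU1 (G : sgraph) (S : {set G}) x y :
  deg_in (x |: S) y <= (deg_in S y).+1.
Proof.
apply: leq_trans (_ : #|x |: [set w in S | adj y w]| <= _).
  apply/subset_leq_card/subsetP=> w; rewrite !inE => /andP[/orP[->//|->] ->].
  by rewrite orbT.
by rewrite cardsU1; case: (_ \notin _).
Qed.

Lemma deg_in_setD (G : sgraph) (S T : {set G}) x :
  T \subset S -> deg_in T x + deg_in (S :\: T) x = deg_in S x.
Proof.
move=> sTS; rewrite /deg_in.
rewrite -(cardsID T [set w in S | adj x w]); congr (_ + _).
  apply: eq_card => w; rewrite !inE.
  by case wT: (w \in T); rewrite ?andbF // (subsetP sTS) //= andbT.
by apply: eq_card => w; rewrite !inE; case: (w \in T); rewrite ?andbF.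
Qed.

Lemma core_sub (G : sgraph) d (S : {set G}) : core d S \subset S.
Proof. by apply/bigcupsP=> W /andP[]. Qed.

Lemma dense_sub_core (G : sgraph) d (W S : {set G}) :
  W \subset S -> dense d W -> W \subset core d S.
Proof.
move=> sWS dW; apply: (bigcup_sup W) => //.
by rewrite sWS dW.
Qed.

Lemma core_dense (G : sgraph) d (S : {set G}) : dense d (core d S).
Proof.
apply/forall_inP=> v /bigcupP[W /andP[sWS dW] vW].
apply: leq_trans (forall_inP dW v vW) _.
by apply: deg_in_mono; apply: dense_sub_core.
Qed.

Lemma core_mono (G : sgraph) d (S T : {set G}) :
  S \subset T -> core d S \subset core d T.
Proof.
move=> sST; apply: dense_sub_core (core_dense d S).
exact: subset_trans (core_sub d S) sST.
Qed.

(** A vertex of the core has more than [d] neighbours in the core, which [x]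
cannot have. *)
Lemma core_setU1 (G : sgraph) d (S : {set G}) x :
  deg_in S x <= d -> core d (x |: S) \subset core d S.
Proof.
move=> dx; apply: dense_sub_core (core_dense _ _).
have xK : x \notin core d (x |: S).
  apply/negP=> xK; have := forall_inP (core_dense d _) x xK.
  rewrite ltnNge; apply/negP; rewrite negbK; apply: leq_trans dx.
  apply/subset_leq_card/subsetP=> w; rewrite !inE => /andP[wK xw].
  rewrite xw andbT; have := subsetP (core_sub d _) w wK; rewrite !inE.
  by case/orP=> // /eqP wx; rewrite wx adj_irrefl in xw.
apply/subsetP=> w wK; have := subsetP (core_sub d _) w wK.
by rewrite !inE => /orP[/eqP wx|//]; move: wK; rewrite wx (negPf xK).
Qed.

(** * Moving vertices between colour classes *)

(** Partial colourings are maps to [option K], with [None] on the uncoloured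
vertices, so that the classes are disjoint by construction. *)
Definition cls (G : sgraph) (K : finType) (f : G -> option K) (a : K) : {set G}
  := [set z | f z == Some a].

Definition recolour (G : sgraph) (K : finType) (f : G -> option K) (x : G)
  (o : option K) : G -> option K := fun z => if z == x then o else f z.

Definition movable (G : sgraph) (K : finType) (d : nat) (f : G -> option K)
  : rel K :=
  [rel a b | [exists z in cls f a, deg_in (cls f b) z <= d]].

Lemma cls_colour (G : sgraph) (K : finType) (f : G -> option K) x i a :
  f x = None ->
  cls (recolour f x (Some i)) a = if a == i then x |: cls f a else cls f a.
Proof.
move=> fx; apply/setP=> z; rewrite !inE /recolour.
case: (altP (a =P i)) => [->|ai]; rewrite !inE; case: (eqVneq z x) => [->|//].
  by rewrite eqxx.
rewrite fx; apply/negbTE; apply: contra ai => /eqP[->].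
exact: eqxx.
Qed.

Lemma cls_uncolour (G : sgraph) (K : finType) (f : G -> option K) x a :
  cls (recolour f x None) a = cls f a :\ x.
Proof. by apply/setP=> z; rewrite !inE /recolour; case: (eqVneq z x). Qed.

Lemma isSome_recolour (G : sgraph) (K : finType) (f : G -> option K) x o z :
  isSome (recolour f x o z) = if z == x then isSome o else isSome (f z).
Proof. by rewrite /recolour; case: eqP. Qed.

Lemma cls_disjoint (G : sgraph) (K : finType) (f : G -> option K) a b z :
  z \in cls f a -> z \in cls f b -> a = b.
Proof. by rewrite !inE => /eqP -> /eqP[]. Qed.

(** The deleted set [Y] is there for the class that receives an extra vertex
[y]: the class has to stay degenerate without [y], while its core is examined
with [y]. *)
Lemma core_setU1D (G : sgraph) d (S Y : {set G}) x :
  deg_in S x <= d -> core d ((x |: S) :\: Y) \subset core d (S :\: Y).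
Proof.
move=> dx; apply: subset_trans (_ : _ \subset core d (x |: (S :\: Y))) _.
  by apply: core_mono; rewrite setDUl setSU // subDset subsetUr.
apply: core_setU1; apply: leq_trans dx.
by apply: deg_in_mono; apply: subsetDl.
Qed.

(** The uncoloured vertex [x] enters class [i] and pushes a vertex of that class
to the next class of the path, and so on. Every class of the path except the
last trades one vertex for another; each vertex enters a class in which it has
at most [d] neighbours, so no core grows. As the path is simple, the first
move leaves the remaining classes, hence the remaining moves, untouched. *)
Lemma shift_along_path (G : sgraph) (K : finType) d (p : seq K) :
  forall (f : G -> option K) x i, f x = None -> deg_in (cls f i) x <= d ->
    path (movable d f) i p -> uniq (i :: p) ->
  exists g : G -> option K,
    [/\ forall z, isSome (g z) = (z == x) || isSome (f z),
        forall a, #|cls g a| = #|cls f a| + (a == last i p),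
        cls f (last i p) \subset cls g (last i p)
      & forall a Y, core d (cls g a :\: Y) \subset core d (cls f a :\: Y)].
Proof.
elim: p => [|j p IHp] f x i fx dx.
  move=> _ _; exists (recolour f x (Some i)); split=> [z|a||a Y].
  - by rewrite isSome_recolour; case: eqP.
  - rewrite cls_colour //=; case: eqP => [->|_]; last by rewrite addn0.
    by rewrite cardsU1 inE fx addnC.
  - by rewrite cls_colour //= eqxx subsetUr.
  - rewrite cls_colour //=; case: eqP => [->|_] //.
    exact: core_setU1D.
rewrite [path _ _ _]/=; case/andP=> /existsP[z /andP[zi dz]] pth unq.
have ij : i != j by move: unq; rewrite /= inE; case: eqP.
have ip : i \notin j :: p by case/andP: unq.
pose f1 := recolour (recolour f x (Some i)) z None.
have f1E a : a != i -> cls f1 a = cls f a.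
  move=> ai; rewrite cls_uncolour cls_colour // (negPf ai).
  apply/setP=> w; rewrite !inE; case: eqP => //= ->.
  apply/esym/eqP=> fz; rewrite inE fz in zi; case/eqP: zi => ia.
  by rewrite ia eqxx in ai.
have f1i : cls f1 i = (x |: cls f i) :\ z.
  by rewrite cls_uncolour cls_colour // eqxx.
have [||||g [g1 g2 g3 g4]] := IHp f1 z j.
- by rewrite /f1 /recolour eqxx.
- by rewrite f1E // eq_sym.
- apply: (sub_in_path (P := [pred a | a != i]) _ _ pth).
    move=> a b; rewrite !inE => ai bi /existsP[w /andP[wa dw]].
    by apply/existsP; exists w; rewrite !f1E // wa.
  by apply/allP=> a ain; apply: contraNneq ip => <-.
- by case/andP: unq.
exists g; split=> [w|a||a Y].
- rewrite g1 !isSome_recolour; case: eqP => [->|_] /=; last by case: eqP.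
  by move: zi; rewrite inE => /eqP ->; rewrite orbT.
- rewrite g2 /=; congr (_ + _); case: (altP (a =P i)) => [->|ai];
    last by rewrite f1E.
  apply/eqP; rewrite -eqSS f1i.
  rewrite -(_ : #|x |: cls f i| = #|cls f i|.+1); last by rewrite cardsU1 inE fx.
  by rewrite (cardsD1 z (x |: _)) 2!inE zi orbT.
- rewrite /= -f1E //; apply: contraNneq ip => <-; exact: mem_last.
- apply: subset_trans (g4 a Y) _; case: (altP (a =P i)) => [->|ai];
    last by rewrite f1E.
  rewrite f1i; apply: subset_trans (core_setU1D Y dx).
  by apply/core_mono/setSD/subD1set.
Qed.

(** Moves out of [j] are excluded so that a chain survives the removal of a vertex
from class [j]; a simple chain that ends at [j] never uses them anyway. *)
Definition heads_to (G : sgraph) (K : finType) d (f : G -> option K) (j : K)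
  : rel K := [rel a b | (a != j) && movable d f a b].

(** Taking [v = x] performs a cyclic exchange that removes [v] from class [j];
taking [x] uncoloured replaces [v] by [x] among the coloured vertices. *)
Lemma reroute (G : sgraph) (K : finType) d (f : G -> option K) (j b : K) v x :
  v \in cls f j -> connect (heads_to d f j) b j ->
  recolour f v None x = None -> deg_in (cls f b :\ v) x <= d ->
  exists g : G -> option K,
    [/\ forall z, isSome (g z) = (z == x) || (z != v) && isSome (f z),
        forall a, #|cls g a| = #|cls f a|,
        cls f j :\ v \subset cls g j
      & forall a Y,
          core d (cls g a :\: Y) \subset core d ((cls f a :\ v) :\: Y)].
Proof.
move=> vj /connectP[p0 pth0 jE]; set h := recolour f v None => hx dx.
case: (shortenP pth0) jE => p pth unq _ jE.
have [||||g] := @shift_along_path G K d p h x b; rewrite -?jE //.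
- by rewrite cls_uncolour.
- apply: sub_path pth => a c /andP[aj /existsP[z /andP[za dz]]].
  apply/existsP; exists z; rewrite !cls_uncolour in_setD1.
  have -> : z != v.
    apply: contraNneq aj => zv.
    by rewrite (cls_disjoint za (_ : z \in cls f j)) // zv.
  rewrite za /=; apply: leq_trans dz.
  exact/deg_in_mono/subD1set.
rewrite cls_uncolour => -[g1 g2 g3 g4]; exists g; split=> // [z|a|a Y].
- by rewrite g1 isSome_recolour; case: (eqVneq z v).
- rewrite g2 cls_uncolour (cardsD1 v (cls f a)) addnC; congr (nat_of_bool _ + _).
  by apply/eqP/idP=> [->//|/cls_disjoint]; apply.
- by rewrite -cls_uncolour.
Qed.

Lemma sum_deg_in_cls (G : sgraph) (K : finType) (f : G -> option K)
    (C : {set K}) (D : {set G}) v c :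
  (forall a, a \in C -> c <= deg_in (cls f a) v) ->
  (forall a, a \in C -> cls f a \subset D) ->
  c * #|C| <= deg_in D v.
Proof.
move=> hc hD; rewrite mulnC -sum_nat_const.
apply: leq_trans (_ : \sum_(a in C) deg_in (cls f a) v <= _).
  exact: leq_sum.
rewrite /deg_in; under eq_bigr do rewrite -sum1_card.
rewrite (exchange_big_dep (mem [set w in D | adj v w])) /=; last first.
  move=> a w aC; rewrite !inE => /andP[fw ->]; rewrite andbT.
  by apply: (subsetP (hD a aC)); rewrite inE.
rewrite -sum1_card; apply: leq_sum => w _.
rewrite sum1_card; case fw: (f w) => [b|].
  rewrite -(card1 b); apply/subset_leq_card/subsetP=> a.
  by rewrite unfold_in => /andP[_]; rewrite !inE fw => /andP[/eqP[->]].
rewrite eq_card0 // => a; apply/negbTE; rewrite unfold_in !inE fw.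
by rewrite andbF.
Qed.

Lemma sum_card_cls (G : sgraph) (K : finType) (f : G -> option K) :
  \sum_a #|cls f a| = #|[set z | isSome (f z)]|.
Proof.
under eq_bigr do rewrite -sum1_card.
rewrite (exchange_big_dep (mem [set z | isSome (f z)])) /=; last first.
  by move=> a w _; rewrite !inE => /eqP ->.
rewrite -sum1_card; apply: eq_bigr => w; rewrite inE.
case fw: (f w) => [b|] // _; apply: (big_pred1 b) => a /=.
by rewrite inE fw; apply/eqP/eqP=> [[]|->].
Qed.

(** * Inserting one more vertex *)

Definition colours (G : sgraph) (K : finType) d (f : G -> option K)
    (U : {set G}) (s : K -> nat) : Prop :=
  [/\ forall z, isSome (f z) = (z \in U),
      forall a, #|cls f a| = s a
    & forall a, core d (cls f a) = set0].

Definition quota (K : finType) (C : {set K}) (t : K -> nat) (a : K) : nat :=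
  if a \in C then t a else 0.

Definition short (K : finType) (j : K) (s : K -> nat) (a : K) : nat :=
  s a - (a == j).

(** If [A] is coloured with [m] colours, an unsaturated vertex of the core of a
class with one extra vertex can be moved to another of the [m] classes: with
more than [d] neighbours in each class, it would have at least [(d + 1) * m]
neighbours in [A] and the extra vertex together. *)
Definition saturated (G : sgraph) (d m : nat) (A : {set G}) (v : G) : bool :=
  d.+1 * m <= (deg_in A v).+1.

Lemma quota_colour (G : sgraph) (K : finType) (f : G -> option K)
    (C : {set K}) t z a :
  (forall a, #|cls f a| = quota C t a) -> f z = Some a -> a \in C.
Proof.
move=> szf fz; apply: contraT => aC; have := szf a.
rewrite /quota (negPf aC) => /eqP; rewrite cards_eq0 => /eqP f0.
by have := in_set0 z; rewrite -f0 inE fz eqxx.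
Qed.

(** The set [A] is coloured with [C], class [j] being one vertex short and filled
up by [y]. The induction is on the size of the core of class [j]. The bound on
the saturated neighbours of [y] is stated inside that core, so that it is
inherited when the core shrinks, although class [j] may receive new saturated
neighbours of [y]. In the second alternative the vertices outside [A2] miss
the bound [d.+1 * #|C2|] by at most one, which can happen when [y] is one of the
[d.+1] neighbours found in class [j]. *)
Lemma insert_or_shrink (G : sgraph) (K : finType) d (A P : {set G})
    (C : {set K}) (t : K -> nat) (j : K) n :
  0 < d -> j \in C -> [disjoint A & P] ->
  forall (f : G -> option K) y,
    #|core d (cls f j)| < n -> y \in P -> f y = Some j ->
    (forall z, isSome (f z) = (z \in y |: A)) ->
    (forall a, #|cls f a| = quota C t a) ->
    (forall a, core d (cls f a :\ y) = set0) ->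
    #|[set v in core d (cls f j) | adj y v && saturated d #|C| A v]| < d ->
  (exists z, exists2 g, z \in P & @colours G K d g (z |: A) (quota C t)) \/
  (exists (C2 : {set K}) (A2 : {set G}) g,
    [/\ [/\ C2 \proper C, j \in C2 & A2 \subset A],
        @colours G K d g A2 (short j (quota C2 t))
      & forall z, z \in P :|: (A :\: A2) ->
          d.+1 * #|C2| <= (deg_in A2 z).+1]).
Proof.
move=> d0 jC dAP; elim: n => [//|n IHn] f y ltn yP fy domf szf degf fewsat.
have yA : y \notin A by move: dAP; rewrite disjoint_sym => /disjointFr ->.
have yj : y \in cls f j by rewrite inE fy.
have clsNy a : a != j -> cls f a :\ y = cls f a.
  move=> aj; apply/setP=> w; rewrite in_setD1; case: eqP => // ->.
  by apply/esym/negbTE; apply: contra aj => /cls_disjoint/(_ yj) ->.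
case: (eqVneq (core d (cls f j)) set0) => [core0|/set0Pn[w0 w0K]].
  left; exists y, f => //; split=> // a.
  by case: (eqVneq a j) => [->//|/clsNy <-].
set Kf := core d (cls f j) in ltn fewsat w0K.
have denseK v : v \in Kf -> d < deg_in Kf v.
  by move=> vK; apply: (forall_inP (core_dense d (cls f j))).
have yK : y \in Kf.
  apply: contraT => yK; have := in_set0 w0; rewrite -(degf j).
  rewrite (subsetP (dense_sub_core _ (core_dense d (cls f j)))) //.
  by rewrite subsetD1 core_sub.
(* [y] has more than [d] neighbours in the core and fewer than [d] of them are
   saturated. *)
have [v /andP[vK yv] vunsat] :
    exists2 v, (v \in Kf) && adj y v & ~~ saturated d #|C| A v.
  apply/exists_inP; apply: contraLR fewsat; rewrite negb_exists_in -leqNgt.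
  move=> /forall_inP allsat; apply: ltnW; apply: leq_trans (denseK y yK) _.
  apply/subset_leq_card/subsetP=> v; rewrite !inE => vK.
  by have := allsat v vK; case/andP: vK => -> -> /negPn.
have vj : v \in cls f j by apply: (subsetP (core_sub d _) v vK).
have fv : f v = Some j by apply/eqP; rewrite inE in vj.
have vy : v != y by apply: contraTneq yv => ->; rewrite adj_irrefl.
have vA : v \in A by have := domf v; rewrite fv !inE (negPf vy).
have [X XC dX] : exists2 X, X \in C & deg_in (cls f X) v <= d.
  apply/exists_inP; apply: contraNT vunsat.
  rewrite negb_exists_in => /forall_inP big.
  apply: leq_trans (deg_in_setU1 A y v); apply: (@sum_deg_in_cls _ _ f).
    by move=> a aC; rewrite ltnNge big.
  by move=> a aC; apply/subsetP=> w; rewrite -domf inE => /eqP ->.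
(* If class [X] leads to [j], a cyclic exchange takes [v] out of the core. *)
case Xacc: (connect (heads_to d f j) X j).
  have [||g [g1 g2 g3 g4]] := @reroute G K d f j X v v vj Xacc.
  - by rewrite /recolour eqxx.
  - by apply: leq_trans dX; apply/deg_in_mono/subD1set.
  have coreg a Y : core d (cls g a :\: Y) \subset core d (cls f a :\: Y).
    by apply: subset_trans (g4 a Y) _; apply/core_mono/setSD/subD1set.
  have coregj : core d (cls g j) \subset Kf by have := coreg j set0; rewrite !setD0.
  apply: (IHn g y) => //.
  - apply: leq_trans (_ : #|Kf| <= n) => //; apply/proper_card/properP; split=> //.
    exists v => //; apply/negP=> vg; have := g4 j set0; rewrite !setD0.
    by move=> /(subset_trans)/(_ (core_sub _ _))/subsetP/(_ v vg); rewrite !inE eqxx.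
  - by apply/eqP; have := subsetP g3 y; rewrite !inE eq_sym vy fy eqxx; apply.
  - by move=> z; rewrite g1 domf; case: (eqVneq z v) => //= ->; rewrite in_setU1 vA orbT.
  - by move=> a; rewrite g2.
  - by move=> a; apply/eqP; rewrite -subset0 -(degf a) coreg.
  - apply: leq_ltn_trans fewsat; apply/subset_leq_card/subsetP=> w.
    by rewrite !inE => /and3P[/(subsetP coregj) -> -> ->].
(* Otherwise [X] is lost, and only the classes leading to [j] are kept. *)
pose C2 := [set a in C | connect (heads_to d f j) a j].
pose A2 := [set w in A | [exists a in C2, f w == Some a]].
have jC2 : j \in C2 by rewrite inE jC connect0.
have clsA2 a : a \in C2 -> cls f a :\ y \subset A2.
  move=> aC2; apply/subsetP=> w; rewrite !inE => /andP[wy /eqP fw].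
  have := domf w; rewrite fw in_setU1 (negPf wy) /= => <- /=.
  by apply/exists_inP; exists a; rewrite // fw.
case: (boolP [exists z in P, [exists b in C2, deg_in (cls f b :\ y) z <= d]]).
  move=> /exists_inP[z zP /exists_inP[b]]; rewrite inE => /andP[bC bacc] dz.
  have zNA : z \notin A by move: dAP; rewrite disjoint_sym => /disjointFr ->.
  have [||g [g1 g2 g3 g4]] := @reroute G K d f j b y z yj bacc => //.
    rewrite /recolour; case: eqP => // /eqP zy; have := domf z.
    by rewrite in_setU1 (negPf zy) (negPf zNA); case: (f z).
  left; exists z, g => //; split=> [w|a|a].
  - rewrite g1 domf !in_setU1; case: (eqVneq w y) => //= ->.
    by rewrite (negPf yA).
  - by rewrite g2.
  - apply/eqP; rewrite -subset0 -(degf a).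
    by have := g4 a set0; rewrite !setD0.
rewrite negb_exists_in => /forall_inP blocked; right.
have degP z b : z \in P -> b \in C2 -> d < deg_in (cls f b :\ y) z.
  move=> zP bC2; have := blocked z zP; rewrite negb_exists_in.
  by move=> /forall_inP/(_ b bC2); rewrite -ltnNge.
exists C2, A2, (fun w => if w \in A2 then f w else None).
set g := fun w => _.
have clsg a : cls g a = if a \in C2 then cls f a :\ y else set0.
  apply/setP=> w; rewrite inE /g; case: (boolP (w \in A2)) => wA2.
    have wy : w != y by apply: contraTneq wA2 => ->; rewrite inE (negPf yA).
    move: wA2; rewrite inE => /andP[wA /exists_inP[b bC2 /eqP fw]].
    case: ifP => aC2; rewrite !inE ?wy // fw.
    by apply/negbTE; apply: contraFneq aC2 => -[<-].
  case: ifP => aC2; rewrite ?inE //; apply/esym/negbTE.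
  by apply: contra wA2 => wa; apply: (subsetP (clsA2 a aC2)); rewrite !inE.
split.
- split=> //; last by apply/subsetP=> w; rewrite inE => /andP[].
  apply/properP; split; first by apply/subsetP=> a; rewrite inE => /andP[].
  by exists X => //; rewrite inE XC Xacc.
- split=> [w|a|a].
  + rewrite /g; case: ifP => // /[!inE] /andP[_ /exists_inP[b _ /eqP ->]] //.
  + rewrite clsg /short /quota; case: ifP => aC2; last by rewrite cards0.
    have := szf a; rewrite /quota (_ : a \in C);
      last by move: aC2; rewrite inE => /andP[].
    rewrite (cardsD1 y) => <-; rewrite inE fy.
    rewrite (_ : (Some j == Some a) = (a == j)) ?addKn // eq_sym.
    by apply/eqP/eqP=> [[]|->].
  + by rewrite clsg; case: ifP => // _; apply/eqP; rewrite -subset0 core_sub.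
- move=> z; rewrite in_setU => /orP[zP|].
    apply: leqW; apply: (@sum_deg_in_cls _ _ g) => a aC2; rewrite clsg aC2.
      exact: degP.
    exact: clsA2.
  rewrite in_setD => /andP[zA2 zA].
  have := domf z; rewrite in_setU1 zA orbT; case fz: (f z) => [c|//] _.
  have cC := quota_colour szf fz.
  have cacc : ~~ connect (heads_to d f j) c j.
    apply: contra zA2 => cacc; rewrite inE zA; apply/exists_inP.
    by exists c; rewrite ?fz // inE cC.
  apply: leq_trans (deg_in_setU1 A2 y z); apply: (@sum_deg_in_cls _ _ f) => b bC2.
    (* A vertex of a discarded class is movable to no kept class, for otherwise
       its own class would lead to [j]. *)
    rewrite ltnNge; apply: contra (cacc) => dz.
    move: (bC2); rewrite inE => /andP[_]; apply: connect_trans.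
    apply: connect1; apply/andP; split.
      by apply: contra cacc => /eqP ->; apply: connect0.
    by apply/existsP; exists z; rewrite inE fz eqxx.
  by have := clsA2 b bC2; rewrite subDset.
Qed.

(** * Existence of the colouring *)

Lemma colours_union (G : sgraph) (K : finType) d (f1 f2 : G -> option K)
    (U1 U2 : {set G}) (C1 C2 : {set K}) (t : K -> nat) :
  [disjoint U1 & U2] -> [disjoint C1 & C2] ->
  colours d f1 U1 (quota C1 t) -> colours d f2 U2 (quota C2 t) ->
  exists f, colours d f (U1 :|: U2) (quota (C1 :|: C2) t).
Proof.
move=> dU dC [dom1 sz1 core1] [dom2 sz2 core2].
pose f z := if f1 z is Some a then Some a else f2 z.
have clsf a : cls f a = if a \in C1 then cls f1 a else cls f2 a.
  apply/setP=> z; rewrite inE /f; case f1z: (f1 z) => [b|].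
    have bC1 := quota_colour sz1 f1z.
    have zU2 : z \notin U2.
      by move: dU => /disjointFr -> //; rewrite -dom1 f1z.
    have f2z : f2 z = None by move: zU2; rewrite -dom2; case: (f2 z).
    case: ifP => aC1; rewrite inE ?f1z // f2z.
    by apply/negbTE; apply: contraFneq aC1 => -[<-].
  case: ifP => aC1; rewrite inE // f1z; apply/negbTE/eqP=> f2z.
  by have := quota_colour sz2 f2z; rewrite (disjointFr dC aC1).
exists f; split=> [z|a|a].
- by rewrite in_setU -dom1 -dom2 /f; case: (f1 z).
- rewrite clsf /quota in_setU; case: ifP => aC1; rewrite ?sz1 ?sz2 /quota ?aC1 //.
- by rewrite clsf; case: ifP.
Qed.

(** Double counting of the edges between [P] and the marked vertices of [V]. *)
Lemma few_marked_neighbours (G : sgraph) (V P : {set G}) (marked : pred G) d e :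
  (forall v, v \in V -> marked v -> deg_in P v <= e) ->
  #|V| * e < d * #|P| ->
  exists2 y, y \in P & #|[set v in V | adj y v && marked v]| < d.
Proof.
move=> he lt; apply/exists_inP; apply: contraLR lt.
rewrite negb_exists_in => /forall_inP many; rewrite -leqNgt mulnC -sum_nat_const.
apply: leq_trans (_ : \sum_(y in P) #|[set v in V | adj y v && marked v]| <= _).
  by apply: leq_sum => y yP; rewrite leqNgt many.
under eq_bigr do rewrite -sum1_card.
rewrite (exchange_big_dep (mem [set v in V | marked v])) /=; last first.
  by move=> y v yP; rewrite !inE => /and3P[-> _ ->].
apply: leq_trans (_ : \sum_(v in [set v in V | marked v]) e <= _).
  apply: leq_sum => v; rewrite inE => /andP[vV mv].
  apply: leq_trans (he v vV mv); rewrite sum1_card.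
  apply/subset_leq_card/subsetP=> y; rewrite unfold_in => /andP[yP].
  by rewrite !inE yP adj_sym => /and3P[_ -> _].
rewrite sum_nat_const leq_mul2r; apply/orP; right.
by apply/subset_leq_card/subsetP=> v; rewrite inE => /andP[].
Qed.

Lemma colours_insert (G : sgraph) (K : finType) d (g : G -> option K)
    (A : {set G}) (C : {set K}) (t : K -> nat) (j : K) y :
  j \in C -> 0 < t j -> y \notin A ->
  colours d g A (short j (quota C t)) ->
  let f := recolour g y (Some j) in
  [/\ f y = Some j,
      forall z, isSome (f z) = (z \in y |: A),
      forall a, #|cls f a| = quota C t a
    & forall a, core d (cls f a :\ y) = set0].
Proof.
move=> jC tj yA [domg szg coreg] f.
have gy : g y = None by move: yA; rewrite -domg; case: (g y).
split=> [|z|a|a].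
- by rewrite /f /recolour eqxx.
- by rewrite isSome_recolour in_setU1 domg; case: eqP.
- rewrite cls_colour // ; case: (eqVneq a j) => [->|aj].
    by rewrite cardsU1 inE gy szg /short /quota eqxx jC subnKC.
  by rewrite szg /short (negPf aj) subn0.
- apply/eqP; rewrite -subset0 -(coreg a); apply: core_mono.
  rewrite cls_colour //; case: (eqVneq a j) => [->|_]; last exact: subD1set.
  by rewrite subDset.
Qed.

(** Induction on the number of colours in use on [A]. Class [j] is one vertex
smaller than its target, and targets differ by at most one, so it is no larger
than the target of any of the [q] unused colours. These targets add up to one
less than the number of vertices outside [A], hence class [j] has fewer than a
[q]-th of that number, as the counting argument needs. *)
Lemma extend_colouring (G : sgraph) (K : finType) d (U : {set G})
    (C : {set K}) (t : K -> nat) (j : K) :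
  0 < d -> j \in C -> 0 < t j ->
  (forall i, i \in C -> t j <= (t i).+1) ->
  \sum_(a in C) t a = #|U| ->
  (forall v, v \in U -> deg_in U v <= d * #|C|.-1) ->
  (forall (W : {set G}) (D : {set K}), W \proper U -> D \subset C ->
     \sum_(a in D) t a = #|W| ->
     (forall v, v \in W -> deg_in W v <= d * #|D|.-1) ->
     exists f, @colours G K d f W (quota D t)) ->
  forall n (C1 : {set K}) (A : {set G}) g,
    #|C1| < n -> j \in C1 -> C1 \subset C -> A \subset U ->
    @colours G K d g A (short j (quota C1 t)) ->
    (forall z, z \in U :\: A -> deg_in (U :\: A) z <= d * #|C :\: C1|.-1) ->
  exists f, @colours G K d f U (quota C t).
Proof.
move=> d0 jC tj teq sumt degU IHU.
elim=> [//|n IHn] C1 A g ltn jC1 sC1 sAU colg degP.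
set P := U :\: A in degP.
have dAP : [disjoint A & P] by rewrite -setI_eq0 setIDA setIC -setIDA setDv setI0.
have [domg szg coreg] := colg.
have cardA : #|A|.+1 = \sum_(a in C1) t a.
  rewrite (_ : A = [set z | isSome (g z)]);
    last by apply/setP=> z; rewrite inE domg.
  rewrite -sum_card_cls (bigD1 j) //= [RHS](bigD1 j) //= szg /short /quota eqxx jC1.
  rewrite -addSn subn1 prednK //; congr (_ + _).
  rewrite big_mkcond [RHS]big_mkcond; apply: eq_bigr => a _.
  by rewrite szg /short /quota; case: eqP => _; case: (a \in C1); rewrite ?subn0.
have cardP : #|P| = (\sum_(a in C :\: C1) t a).+1.
  have := cardsID A U; rewrite (setIidPr sAU) -/P -sumt.
  rewrite (big_setID C1) /= (setIidPr sC1) -cardA addSn -addnS; exact: addnI.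
have cardC : #|C| = #|C1| + #|C :\: C1|.
  by rewrite -(cardsID C1 C) (setIidPr sC1).
have m0 : 0 < #|C1| by rewrite (cardsD1 j) jC1.
have degAP z : z \in U -> deg_in A z + deg_in P z <= d * #|C|.-1.
  by move=> zU; rewrite deg_in_setD // degU.
have [y yP yfew] : exists2 y, y \in P &
    #|[set v in cls g j | adj y v && saturated d #|C1| A v]| < d.
  (* Saturated vertices have degree at most [d * q] into [P]; when [q = 0] there
     are none, since [d * (m - 1) < d.+1 * m - 1]. *)
  apply: (few_marked_neighbours (e := d * #|C :\: C1|)) => [v|].
    rewrite inE => /eqP gv; rewrite /saturated => vs.
    have vU : v \in U by apply: (subsetP sAU); rewrite -domg gv.
    by have := degAP v vU; nia.
  rewrite mulnCA ltn_pmul2l // cardP ltnS szg mulnC -sum_nat_const.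
  apply: leq_sum => a; rewrite inE => /andP[_ aC].
  by rewrite /short /quota eqxx jC1; have := teq a aC; lia.
have yA : y \notin A by move: yP; rewrite inE => /andP[].
have [fy domf szf degf] := colours_insert jC1 tj yA colg.
set f := recolour g y (Some j) in fy domf szf degf.
have gy : g y = None by move: yA; rewrite -domg; case: (g y).
have := @insert_or_shrink G K d A P C1 t j #|core d (cls f j)|.+1 d0 jC1 dAP
  f y (ltnSn _) yP fy domf szf degf.
case.
- apply: leq_ltn_trans yfew; apply/subset_leq_card/subsetP=> v.
  rewrite inE => /and3P[vK yv sv]; rewrite inE yv sv !andbT.
  have := subsetP (core_sub d _) v vK; rewrite cls_colour // eqxx in_setU1.
  by case/orP=> // /eqP vy; rewrite vy adj_irrefl in yv.
- move=> [z [h zP colh]].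
  have [zA zU] : z \notin A /\ z \in U by move: zP; rewrite inE => /andP[].
  have [||||f2 colf2] := IHU (P :\ z) (C :\: C1).
  + apply/properP; split; first exact: subset_trans (subD1set _ _) (subsetDl _ _).
    by exists z => //; rewrite !inE eqxx.
  + exact: subsetDl.
  + by apply: succn_inj; rewrite -cardP (cardsD1 z P) zP.
  + move=> v /[!inE] /andP[vz vP]; apply: leq_trans (degP v _); last by rewrite inE.
    exact/deg_in_mono/subD1set.
  have [||f3] := colours_union _ _ colh colf2.
  + rewrite -setI_eq0; apply/eqP/setP=> w; rewrite !inE.
    by case: (w == z); case: (w \in A); rewrite ?andbF.
  + by rewrite -setI_eq0 setIDA setIC -setIDA setDv setI0.
  rewrite (_ : C1 :|: C :\: C1 = C);
    last by rewrite -[RHS](setID C C1) (setIidPr sC1).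
  move=> colf3; exists f3; suff -> : U = (z |: A) :|: (P :\ z) by [].
  apply/setP=> w; rewrite !inE; case: (eqVneq w z) => [->|_] //=.
  by case: (boolP (w \in A)) => // /(subsetP sAU) ->.
- move=> [C2 [A2 [h [[pC2 jC2 sA2] colh degh]]]].
  have sC2 : C2 \subset C by apply: subset_trans (proper_sub pC2) sC1.
  apply: (IHn C2 A2 h) => //.
  + exact: leq_trans (proper_card pC2) _.
  + exact: subset_trans sA2 sAU.
  move=> z zP2; have zU : z \in U by move: zP2; rewrite inE => /andP[].
  have dz : d.+1 * #|C2| <= (deg_in A2 z).+1.
    apply: degh; move: zP2; rewrite !inE => /andP[-> ->].
    by rewrite andbT; case: (z \in A).
  have := degU z zU; rewrite -(@deg_in_setD _ U A2);
    last exact: subset_trans sA2 sAU.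
  have := cardsID C2 C; rewrite (setIidPr sC2).
  have : 0 < #|C2| by rewrite (cardsD1 j) jC2.
  move: dz; nia.
Qed.

(** The target sizes [t] are prescribed, rather than only required to be balanced,
because the induction combines colourings of two parts with disjoint sets of
colours. *)
Lemma exists_colouring (G : sgraph) (K : finType) d (U : {set G})
    (C : {set K}) (t : K -> nat) :
  0 < d -> {in C &, forall i j, t j <= (t i).+1} ->
  \sum_(a in C) t a = #|U| ->
  (forall v, v \in U -> deg_in U v <= d * #|C|.-1) ->
  exists f, @colours G K d f U (quota C t).
Proof.
move=> d0; have [n] := ubnP #|U|.
elim: n U C t => [//|n IHn] U C t ltn teq sumt degU.
have [U0|/set0Pn[y yU]] := eqVneq U set0.
  exists (fun=> None); have cls0 a : cls (fun=> None) a = set0 :> {set G}.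
    by apply/setP=> z; rewrite !inE.
  split=> [z|a|a]; rewrite ?cls0 ?U0 ?inE //.
    rewrite cards0 /quota; case: ifP => // aC; apply/esym/eqP.
    move: sumt; rewrite U0 cards0 => /eqP.
    by rewrite sum_nat_eq0 => /forall_inP/(_ a aC).
  by apply/eqP; rewrite -subset0 core_sub.
have [c cC tc] : exists2 c, c \in C & 0 < t c.
  apply/exists_inP; apply: contraLR (yU); rewrite negb_exists_in => /forall_inP t0.
  suff /eqP : #|U| = 0 by rewrite cards_eq0 => /eqP ->; rewrite inE.
  rewrite -sumt big1 // => a aC; apply/eqP.
  by have := t0 a aC; rewrite -leqNgt leqn0.
(* Lowering a largest target by one keeps the targets balanced. *)
case: (arg_maxnP t cC) => j jC jmax.
have tj : 0 < t j by apply: leq_trans tc (jmax c cC).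
have [||||g colg] := IHn (U :\ y) C (short j t).
- by move: ltn; rewrite (cardsD1 y) yU.
- move=> a b aC bC; rewrite /short.
  have := teq a b aC bC; have := teq a j aC jC.
  have := jmax a aC; have := jmax b bC.
  by case: (eqVneq b j); case: (eqVneq a j) => *; subst; lia.
- apply: succn_inj; rewrite -[RHS](_ : #|U| = _); last by rewrite (cardsD1 y) yU.
  rewrite -sumt (bigD1 j) //= [RHS](bigD1 j) //= /short eqxx subn1 -addSn prednK //.
  by congr (_ + _); apply: eq_bigr => a /andP[_ /negPf ->]; rewrite subn0.
- move=> v /[!inE] /andP[_ vU]; apply: leq_trans (degU v vU).
  exact/deg_in_mono/subD1set.
(* Initially all colours are in use and [y] is the only vertex outside [A]. *)
apply: (@extend_colouring G K d U C t j d0 jC tj _ sumt degU _ #|C|.+1 C (U :\ y) g) => //.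
- by move=> i iC; apply: teq.
- move=> W D pW sD sumD degW; apply: IHn => //.
    exact: leq_trans (proper_card pW) _.
  by move=> i k iD kD; apply: teq; apply: (subsetP sD).
- exact: subD1set.
- have [? szg ?] := colg; split=> // a; rewrite szg /short /quota.
  by case: ifP => // _; rewrite sub0n.
- rewrite setDDr setDv set0U (setIidPr _) ?sub1set // => z /[!inE] /eqP ->.
  rewrite (_ : deg_in _ _ = 0) //; apply: eq_card0 => w; rewrite !inE.
  by case: eqP => //= ->; rewrite adj_irrefl.
Qed.

Lemma sum_equitable_sizes (k n : nat) :
  0 < k -> \sum_(i < k) (n %/ k + (i < n %% k)) = n.
Proof.
move=> k0; rewrite big_split /= sum_nat_const card_ord.
rewrite -(big_mkord xpredT (fun i => nat_of_bool (i < n %% k))).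
rewrite (big_cat_nat (n := n %% k)) //=; last exact: ltnW (ltn_pmod _ _).
rewrite (eq_big_nat _ _ (F2 := fun=> 1)); last by move=> i /andP[_ ->].
rewrite [X in _ + (_ + X)](eq_big_nat _ _ (F2 := fun=> 0)); last first.
  by move=> i /andP[hi _]; rewrite ltnNge hi.
by rewrite !sum_nat_const_nat muln0 addn0 muln1 subn0 mulnC -divn_eq.
Qed.

(** An arbitrary subgraph on [W] has at most the degrees of the induced one, and
the latter is not dense. *)
Lemma core0_degenerate (G : sgraph) d (S : {set G}) :
  core d S = set0 -> degenerate d (induced S).
Proof.
move=> core0 W f [_ fsub] Wn0.
pose W' : {set G} := [set val x | x in W].
have : ~~ dense d W'.
  apply: contra Wn0 => dW; rewrite -subset0.
  have sW : W' \subset S by apply/subsetP=> _ /imsetP[x _ ->]; apply: valP.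
  have := dense_sub_core sW dW; rewrite core0 => /subsetP W0.
  by apply/subsetP=> x xW; have := W0 _ (imset_f val xW); rewrite inE.
rewrite /dense negb_forall_in => /exists_inP[_ /imsetP[x xW ->]].
rewrite -leqNgt => dx; exists x => //; apply: leq_trans dx.
rewrite -(card_imset _ val_inj); apply/subset_leq_card/subsetP=> _ /imsetP[z + ->].
by rewrite !inE => /fsub[_ zW xz]; rewrite imset_f.
Qed.

Unset Implicit Arguments.

Theorem theorem1p6 (Delta d k : nat)
    (hDelta : 0 < Delta) (hd : 0 < d) (hk : 0 < k)
    (hkd : (Delta%:R / d%:R + 1 <= k%:R :> rat)%R)
    (G : sgraph) (hG : max_degree G <= Delta) :
  exists phi : colouring k G, equitable phi /\ degenerate_colouring d phi.
Proof.
have hkn : Delta <= d * k.-1.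
  move: hkd; rewrite -Num.Theory.lerBrDr Num.Theory.ler_pdivrMr ?Num.Theory.ltr0n //.
  rewrite -{1}(prednK hk) -GRing.natr1 GRing.addrK -GRing.natrM Num.Theory.ler_nat.
  by rewrite mulnC.
pose t (i : 'I_k) := #|G| %/ k + (i < #|G| %% k).
have [|||f [domf szf coref]] :=
    @exists_colouring G _ d [set: G] [set: 'I_k] t hd.
- by move=> i j _ _; rewrite /t -addnS leq_add2l; case: (_ < _).
- rewrite cardsT -[RHS](sum_equitable_sizes #|G| hk).
  by apply: eq_bigl => i; rewrite inE.
- move=> v _; rewrite cardsT card_ord; apply: leq_trans hkn; apply: leq_trans hG.
  apply: leq_trans (leq_bigmax v); apply/subset_leq_card/subsetP=> w.
  by rewrite !inE.
pose phi : colouring k G := [ffun v => odflt (Ordinal hk) (f v)].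
have clsE i : colour_class phi i = cls f i.
  apply/setP=> v; rewrite !inE ffunE; have := domf v; rewrite inE.
  by case: (f v).
exists phi; split=> [i j|i].
  rewrite !clsE !szf /quota !inE /t -addnA leq_add2l.
  by case: (_ < _); case: (_ < _).
by rewrite clsE; apply: core0_degenerate.
Qed.
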